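(* Let $M$ be a finitely generated $A_n$-module and let $$\chi(t)=\sum_{i=0}^{2n}a_i\binom{t+i}{i}$$ be the Bernstein polynomial associated with some finite system of generators $\{f_1,\dots,f_m\}$ of $M$, written with integer coefficients $a_i$ $(0\le i\le 2n)$. Then the numbers $a_{2n}$, $d=\deg(\chi(t))$ and $a_d$ do not depend on the finite system of generators of the $A_n$-module $M$ with which this polynomial is associated.
   Context: Let $K$ be a field of characteristic $0$ and $n\ge 1$. $A_n=A_n(K)$ is the $n$th Weyl algebra: the $K$-subalgebra of $\mathrm{End}_K(K[x_1,\dots,x_n])$ generated by the multiplication operators $x_1,\dots,x_n$ and the partial derivatives $\partial_1,\dots,\partial_n$. Modules are unitary left modules. $\mathbb N$ includes $0$. The monomials $x^\alpha\partial^\beta=x_1^{\alpha_1}\cdots x_n^{\alpha_n}\partial_1^{\beta_1}\cdots\partial_n^{\beta_n}$ ($\alpha,\beta\in\mathbb N^n$) form a $K$-basis of $A_n$; the degree of $x^\alpha\partial^\beta$ is $\sum_i\alpha_i+\sum_i\beta_i$. The Bernstein filtration is $\{B_r\}_{r\in\mathbb N}$, where $B_r$ is the $K$-span of the monomials of degree $\le r$. For a finite system of generators $\{f_1,\dots,f_m\}$ of an $A_n$-module $M$, put $M_r=\sum_{i=1}^mB_rf_i$. The Bernstein polynomial of $M$ associated with this system of generators is the polynomial $\chi(t)\in\mathbb Q[t]$ with $\chi(r)=\dim_KM_r$ for all sufficiently large $r\in\mathbb N$; it exists, has degree at most $2n$, takes integer values at all sufficiently large $r\in\mathbb N$, and can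 be uniquely written as $\chi(t)=\sum_{i=0}^{2n}a_i\binom{t+i}{i}$ with $a_i\in\mathbb Z$, where $\binom{t+i}{i}=(t+i)(t+i-1)\cdots(t+1)/i!$ and $\binom{t}{0}=1$. Convention: the zero polynomial has degree $-1$, and in that case $a_d$ is read as $0$. *)

(* Defs.v *)
From HB Require Import structures.
From mathcomp Require Import all_boot all_order all_algebra.
From mathcomp Require Import mpoly.
From mathcomp Require Import boolp.

Set Implicit Arguments.
Unset Strict Implicit.
Unset Printing Implicit Defensive.

Import GRing.Theory.
Local Open Scope ring_scope.

(* The classical axioms of boolp are only used to give a choiceType structure *)
(* to the endomorphisms of K[x_1, ..., x_n], and a boolean membership test to  *)
(* the Weyl algebra.                                                           *)

Section PolyEnd.
Variables (K : fieldType) (n : nat).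

Definition polyEnd : Type := {linear {mpoly K[n]} -> {mpoly K[n]}}.

HB.instance Definition _ := gen_eqMixin polyEnd.
HB.instance Definition _ := gen_choiceMixin polyEnd.

Implicit Types f g h : polyEnd.

Lemma polyEndP f g : (forall p, f p = g p) -> f = g.
Proof.
case: f g => [f cf] [g cg] /= efg.
have {}efg : f = g by apply: funext.
move: cg; rewrite -{}efg => cg; congr GRing.Linear.Pack.
case: cf cg => [[a1] [b1]] [[a2] [b2]].
by rewrite (Prop_irrelevance a1 a2) (Prop_irrelevance b1 b2).
Qed.

Definition polyEnd_zero : polyEnd := \0.
Definition polyEnd_opp f : polyEnd := \- f.
Definition polyEnd_add f g : polyEnd := f \+ g.
Definition polyEnd_one : polyEnd := idfun.
Definition polyEnd_mul f g : polyEnd := f \o g.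
Definition polyEnd_scale (a : K) f : polyEnd := a \*: f.

Fact polyEnd_addA : associative polyEnd_add.
Proof. by move=> f g h; apply: polyEndP => p; exact: addrA. Qed.
Fact polyEnd_addC : commutative polyEnd_add.
Proof. by move=> f g; apply: polyEndP => p; exact: addrC. Qed.
Fact polyEnd_add0 : left_id polyEnd_zero polyEnd_add.
Proof. by move=> f; apply: polyEndP => p; exact: add0r. Qed.
Fact polyEnd_addN : left_inverse polyEnd_zero polyEnd_opp polyEnd_add.
Proof. by move=> f; apply: polyEndP => p; exact: addNr. Qed.

HB.instance Definition _ := GRing.isZmodule.Build polyEnd
  polyEnd_addA polyEnd_addC polyEnd_add0 polyEnd_addN.

Fact polyEnd_mulA : associative polyEnd_mul.
Proof. by move=> f g h; apply: polyEndP. Qed.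
Fact polyEnd_mul1 : left_id polyEnd_one polyEnd_mul.
Proof. by move=> f; apply: polyEndP. Qed.
Fact polyEnd_1mul : right_id polyEnd_one polyEnd_mul.
Proof. by move=> f; apply: polyEndP. Qed.
Fact polyEnd_mulDl : left_distributive polyEnd_mul +%R.
Proof. by move=> f g h; apply: polyEndP. Qed.
Fact polyEnd_mulDr : right_distributive polyEnd_mul +%R.
Proof. by move=> f g h; apply: polyEndP => p; exact: raddfD. Qed.
Fact polyEnd_oner_neq0 : polyEnd_one != 0.
Proof.
apply/eqP => /(congr1 (fun f : polyEnd => f 1)) /eqP.
by rewrite (_ : (0 : polyEnd) 1 = 0) // oner_eq0.
Qed.

HB.instance Definition _ := GRing.Zmodule_isNzRing.Build polyEnd
  polyEnd_mulA polyEnd_mul1 polyEnd_1mul polyEnd_mulDl polyEnd_mulDr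
  polyEnd_oner_neq0.

Fact polyEnd_scaleA a b f :
  polyEnd_scale a (polyEnd_scale b f) = polyEnd_scale (a * b) f.
Proof. by apply: polyEndP => p; exact: scalerA. Qed.
Fact polyEnd_scale1 : left_id 1 polyEnd_scale.
Proof. by move=> f; apply: polyEndP => p; exact: scale1r. Qed.
Fact polyEnd_scaleDr : right_distributive polyEnd_scale +%R.
Proof. by move=> a f g; apply: polyEndP => p; exact: scalerDr. Qed.
Fact polyEnd_scaleDl f : {morph polyEnd_scale^~ f : a b / a + b}.
Proof. by move=> a b; apply: polyEndP => p; exact: scalerDl. Qed.

HB.instance Definition _ := GRing.Zmodule_isLmodule.Build K polyEnd
  polyEnd_scaleA polyEnd_scale1 polyEnd_scaleDr polyEnd_scaleDl.

Fact polyEnd_scaleAl (a : K) f g : a *: (f * g) = (a *: f) * g.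
Proof. by apply: polyEndP. Qed.

HB.instance Definition _ :=
  GRing.Lmodule_isLalgebra.Build K polyEnd polyEnd_scaleAl.

Fact polyEnd_scaleAr (a : K) f g : a *: (f * g) = f * (a *: g).
Proof. by apply: polyEndP => p; apply/esym; exact: linearZ. Qed.

HB.instance Definition _ :=
  GRing.Lalgebra_isAlgebra.Build K polyEnd polyEnd_scaleAr.

Definition mulX (i : 'I_n) (p : {mpoly K[n]}) : {mpoly K[n]} := 'X_i * p.

Fact mulX_is_linear i : linear (mulX i).
Proof. by move=> a p q; rewrite /mulX mulrDr scalerAr. Qed.

HB.instance Definition _ i := GRing.isLinear.Build K
  {mpoly K[n]} {mpoly K[n]} _ (mulX i) (mulX_is_linear i).

Definition mulXop (i : 'I_n) : polyEnd := mulX i.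
Definition derivop (i : 'I_n) : polyEnd := mderiv i.

End PolyEnd.

Section Weyl.
Variables (K : fieldType) (n : nat).

Inductive in_weyl : polyEnd K n -> Prop :=
| in_weyl_X i : in_weyl (mulXop K i)
| in_weyl_D i : in_weyl (derivop K i)
| in_weyl1 : in_weyl 1
| in_weylZ a f : in_weyl f -> in_weyl (a *: f)
| in_weylA f g : in_weyl f -> in_weyl g -> in_weyl (f + g)
| in_weylM f g : in_weyl f -> in_weyl g -> in_weyl (f * g).

Definition weyl_pred : {pred polyEnd K n} := fun f => `[< in_weyl f >].

Fact weyl_subalg_closed : subalg_closed weyl_pred.
Proof.
split=> [|a f g /asboolP wf /asboolP wg|f g /asboolP wf /asboolP wg].
- exact/asboolP/in_weyl1.
- exact/asboolP/in_weylA/wg/in_weylZ.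
- exact/asboolP/in_weylM.
Qed.

HB.instance Definition _ :=
  GRing.isSubalgClosed.Build K (polyEnd K n) weyl_pred weyl_subalg_closed.

Record weyl : Type := Weyl { weyl_val :> polyEnd K n; _ : weyl_val \in weyl_pred }.

HB.instance Definition _ := [isSub for weyl_val].
HB.instance Definition _ := [Choice of weyl by <:].
HB.instance Definition _ := [SubChoice_isSubAlgebra of weyl by <:].

Definition weylX (i : 'I_n) : weyl := Weyl (asboolT (in_weyl_X i)).
Definition weylD (i : 'I_n) : weyl := Weyl (asboolT (in_weyl_D i)).

Definition weyl_monomial (alpha beta : 'X_{1..n}) : weyl :=
  (\prod_(i < n) weylX i ^+ alpha i) * (\prod_(i < n) weylD i ^+ beta i).

End Weyl.

Section VectorSpaces.
Variables (K : fieldType) (V : lmodType K).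

Definition in_span (S : V -> Prop) (v : V) : Prop :=
  exists k (c : 'I_k -> K) (s : 'I_k -> V),
    (forall i, S (s i)) /\ v = \sum_i c i *: s i.

Definition is_basis (S : V -> Prop) (d : nat) (b : 'I_d -> V) : Prop :=
  (forall c : 'I_d -> K, \sum_i c i *: b i = 0 -> forall i, c i = 0)
  /\ (forall v, S v <-> exists c : 'I_d -> K, v = \sum_i c i *: b i).

Definition has_dim (S : V -> Prop) (d : nat) : Prop :=
  exists b : 'I_d -> V, is_basis S b.

End VectorSpaces.

Definition restrict_scalars (K : fieldType) (A : algType K) (M : lmodType A) :
  Type := M.

Section RestrictScalars.
Variables (K : fieldType) (A : algType K) (M : lmodType A).
Local Notation MK := (restrict_scalars M).

HB.instance Definition _ := GRing.Zmodule.on MK.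

Definition restrict_scale (a : K) (m : MK) : MK := (a%:A : A) *: (m : M).

Fact restrict_scaleA a b m :
  restrict_scale a (restrict_scale b m) = restrict_scale (a * b) m.
Proof. by rewrite /restrict_scale scalerA -scalerAl mul1r scalerA. Qed.
Fact restrict_scale1 : left_id 1 restrict_scale.
Proof. by move=> m; rewrite /restrict_scale !scale1r. Qed.
Fact restrict_scaleDr : right_distributive restrict_scale +%R.
Proof. by move=> a m m'; exact: scalerDr. Qed.
Fact restrict_scaleDl m : {morph restrict_scale^~ m : a b / a + b}.
Proof. by move=> a b; rewrite /restrict_scale !scalerDl. Qed.

HB.instance Definition _ := GRing.Zmodule_isLmodule.Build K MK
  restrict_scaleA restrict_scale1 restrict_scaleDr restrict_scaleDl.

End RestrictScalars.

Section Bernstein.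
Variables (K : fieldType) (n : nat).

Definition bernstein_filtration (r : nat) : weyl K n -> Prop :=
  in_span (fun w => exists alpha beta : 'X_{1..n},
    (mdeg alpha + mdeg beta <= r)%N /\ w = weyl_monomial K alpha beta).

Variables (M : lmodType (weyl K n)) (m : nat) (f : 'I_m -> M).

Definition generates : Prop :=
  forall v : M, exists w : 'I_m -> weyl K n, v = \sum_i w i *: f i.

Definition module_filtration (r : nat) (v : M) : Prop :=
  exists b : 'I_m -> weyl K n,
    (forall i, bernstein_filtration r (b i)) /\ v = \sum_i b i *: f i.

Definition is_bernstein_poly (chi : {poly rat}) : Prop :=
  exists r0 : nat, forall r : nat, (r0 <= r)%N ->
    exists d : nat,
      has_dim (V := restrict_scalars M) (module_filtration r) d
      /\ chi.[r%:R] = d%:R.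

End Bernstein.

(* binom(t + i, i) = (t + 1)(t + 2)...(t + i) / i! *)
Definition binom_poly (i : nat) : {poly rat} :=
  (i`!%:R)^-1 *: \prod_(1 <= j < i.+1) ('X + j%:R%:P).

(* The coefficients a_0, ..., a_(2n) are the values of a sequence on 0..2n;    *)
(* its other values play no role.                                              *)
Definition binom_expansion (n : nat) (a : nat -> int) (chi : {poly rat}) :
  Prop := chi = \sum_(0 <= i < n.*2.+1) (a i)%:~R *: binom_poly i.

(* With this convention the zero polynomial has degree -1. *)
Definition poly_degree (p : {poly rat}) : int := (size p)%:Z - 1.

Definition coef_at_degree (a : nat -> int) (d : int) : int :=
  if d is Posz k then a k else 0.

(* Main.v *)
(* Right multiplication by a fixed element of A_n shifts the Bernstein          *)
(* filtration by a constant. Expressing one system of generators in the other  *)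
(* therefore gives k with M'_r inside M_(r+k) for all r, whence                *)
(* chi'(r) <= chi(r + k) for large r, and symmetrically. As both polynomials   *)
(* are eventually nonnegative, they have the same degree d and the same        *)
(* leading coefficient, which is a_d / d!; and a_(2n) / (2n)! is the           *)
(* coefficient of t^(2n).                                                      *)

Require Import Defs.
From mathcomp Require Import all_boot all_order all_algebra.
From mathcomp Require Import mpoly.
From mathcomp Require Import boolp polyrcf zify.

Set Implicit Arguments.
Unset Strict Implicit.
Unset Printing Implicit Defensive.

Import Order.TTheory GRing.Theory Num.Theory.
Local Open Scope ring_scope.

(** Right multiplication by a fixed operator raises the Bernstein degree by a bounded amount
    ([bernstein_mulr_shift]), so the filtrations of two generating systems contain each other up to
    an index shift ([module_filtration_shift]). Dimension is monotone, hence each polynomial is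
    eventually at most a translate of the other ([bernstein_poly_shift]). Translation preserves
    degree and leading coefficient, so both invariants agree ([eventually_le_size],
    [eventually_le_lead_coef]). They determine $a_{2n}$ and $a_d$ because the binomial of index $i$
    has degree $i$ and leading coefficient $1/i!$ ([coef_binom_sum_top],
    [coef_at_degree_binom_sum]). *)

Lemma lead_coef_ge0 (p : {poly rat}) (r0 : nat) :
  (forall r, (r0 <= r)%N -> 0 <= p.[r%:R]) -> 0 <= lead_coef p.
Proof.
move=> p_ge0; rewrite leNgt; apply/negP => lp_lt0.
have lNp : 0 < lead_coef (- p) by rewrite lead_coefN oppr_gt0.
(* Beyond some [x], [- p] stays at least its positive leading coefficient; the Archimedean property
   supplies an integer [r] past both [x] and [r0]. *)
have [x gtx] := poly_pinfty_gt_lc lNp.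
pose r := (r0 + Num.bound `|x|)%N.
have /gtx : x <= r%:R.
  rewrite (le_trans (ler_norm x)) // (le_trans (ltW (archi_boundP _))) //.
  by rewrite ler_nat leq_addl.
rewrite leNgt hornerN => /negP; apply; apply: le_lt_trans lNp.
by rewrite oppr_le0 p_ge0 ?leq_addr.
Qed.

(** * Degree and leading coefficient under an eventual inequality *)

Section Comparison.
Variables (p q : {poly rat}) (r0 k : nat).
Hypothesis p_ge0 : forall r, (r0 <= r)%N -> 0 <= p.[r%:R].
Hypothesis le_pq : forall r, (r0 <= r)%N -> p.[r%:R] <= q.[(r + k)%:R].

Let s := q \Po ('X + k%:R%:P).

Let size_s : size s = size q.
Proof. by rewrite size_comp_poly2 // size_XaddC. Qed.

Let lead_s : lead_coef s = lead_coef q.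
Proof.
by rewrite lead_coef_comp ?size_XaddC // lead_coefXaddC expr1n mulr1.
Qed.

Let lead_sBp : 0 <= lead_coef (s - p).
Proof.
apply: (@lead_coef_ge0 _ r0) => r /le_pq.
by rewrite hornerD hornerN horner_comp !hornerE -natrD subr_ge0.
Qed.

(** If [p] had the larger degree, [s - p] would have leading coefficient [- lead_coef p]. Eventual
    nonnegativity of [p] and of [s - p] then forces [lead_coef p = 0], so [p = 0], which is
    absurd. *)
Lemma eventually_le_size : (size p <= size q)%N.
Proof.
rewrite leqNgt; apply/negP => lt_qp; move: lead_sBp.
rewrite addrC lead_coefDl ?size_polyN ?size_s // lead_coefN oppr_ge0 => lp.
have /eqP : lead_coef p = 0 by apply: le_anti; rewrite lp (lead_coef_ge0 p_ge0).
by rewrite lead_coef_eq0 => /eqP p0; rewrite p0 size_poly0 in lt_qp.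
Qed.

Lemma eventually_le_lead_coef :
  size p = size q -> lead_coef p <= lead_coef q.
Proof.
move=> eq_pq; rewrite leNgt -lead_s -subr_lt0; apply/negP => lt_sp.
have coef_sBp : (s - p)`_(size p).-1 = lead_coef s - lead_coef p.
  by rewrite coefB !lead_coefE size_s eq_pq.
have sz_le : (size (s - p)%R <= size p)%N.
  by rewrite (leq_trans (size_polyD _ _)) // size_polyN size_s eq_pq maxnn.
(* The leading terms do not cancel, so [s - p] has the degree of [p] and its leading coefficient is
   the negative difference. *)
have sz_gt : ((size p).-1 < size (s - p)%R)%N.
  rewrite ltnNge; apply/negP => /(nth_default 0).
  by rewrite coef_sBp => sp0; rewrite sp0 ltxx in lt_sp.
move: lead_sBp; rewrite lead_coefE (_ : _.-1 = (size p).-1); last by lia.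
by rewrite coef_sBp leNgt lt_sp.
Qed.

End Comparison.

(** * Reading coefficients off the binomial expansion *)

Section BinomPoly.

Lemma size_binom_poly i : size (binom_poly i) = i.+1.
Proof.
rewrite size_scale ?invr_eq0 ?pnatr_eq0 -?lt0n ?fact_gt0 //.
elim: i => [|i IHi]; first by rewrite big_nil size_poly1.
rewrite big_nat_recr //= size_Mmonic ?monicXaddC // -?size_poly_gt0 ?IHi //.
by rewrite size_XaddC addn2.
Qed.

Lemma lead_coef_binom_poly i : lead_coef (binom_poly i) = (i`!%:R)^-1.
Proof.
rewrite lead_coefZ lead_coef_prod big1 ?mulr1 // => j _.
exact: lead_coefXaddC.
Qed.

Variable a : nat -> int.
Let chi N := \sum_(0 <= i < N) (a i)%:~R *: binom_poly i.

Lemma size_binom_sum N : (size (chi N) <= N)%N.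
Proof.
rewrite /chi big_mkord (leq_trans (size_sum _ _ _)) //.
apply/bigmax_leqP => i _.
by rewrite (leq_trans (size_scale_leq _ _)) // size_binom_poly.
Qed.

Lemma coef_binom_sum_top N : (a N)%:~R = (chi N.+1)`_N * N`!%:R.
Proof.
rewrite /chi big_nat_recr //= coefD nth_default ?size_binom_sum // add0r.
rewrite coefZ; have := lead_coef_binom_poly N.
rewrite lead_coefE size_binom_poly /= => ->.
by rewrite mulfVK // pnatr_eq0 -lt0n fact_gt0.
Qed.

Lemma coef_at_degree_binom_sum N :
  (coef_at_degree a (poly_degree (chi N)))%:~R
    = lead_coef (chi N) * ((size (chi N)).-1)`!%:R.
Proof.
elim: N => [|N IHN].
  by rewrite /chi big_nil /poly_degree size_poly0 lead_coef0 mul0r.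
have [aN0|aN0] := eqVneq (a N) 0.
  have -> // : chi N.+1 = chi N.
  by rewrite /chi big_nat_recr //= aN0 scale0r addr0.
have szN : size (chi N.+1) = N.+1.
  apply/eqP; rewrite eqn_leq size_binom_sum ltnNge; apply/negP.
  move=> /(nth_default 0) c0; have := coef_binom_sum_top N.
  by rewrite c0 mul0r => /eqP; rewrite intr_eq0 (negPf aN0).
rewrite /poly_degree lead_coefE szN -coef_binom_sum_top.
by rewrite -[N.+1]addn1 PoszD addrK.
Qed.

End BinomPoly.

(** * Dimensions and spans *)

Lemma has_dim_le (K : fieldType) (V : lmodType K) (S T : V -> Prop) d e :
  (forall v, S v -> T v) -> has_dim S d -> has_dim T e -> (d <= e)%N.
Proof.
move=> sST [b [b_free b_span]] [c [c_free c_span]].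
have /choice [C bE] (i : 'I_d) : exists u : 'I_e -> K, b i = \sum_j u j *: c j.
  apply/c_span/sST/b_span; exists (fun j => (j == i)%:R).
  rewrite (bigD1 i) //= eqxx scale1r big1 ?addr0 // => j /negPf ->.
  by rewrite scale0r.
(* A row vector killed by the coordinate matrix is a linear relation among the [b i], so the matrix
   has rank [d], which is at most its number [e] of columns. *)
have /eqP <- : row_free (\matrix_(i, j) C i j); last exact: rank_leq_col.
apply: inj_row_free => v vC; apply/rowP => i; rewrite mxE.
apply: (b_free (v 0)); under eq_bigr do rewrite bE scaler_sumr.
rewrite exchange_big big1 //= => j _.
under eq_bigr do rewrite scalerA.
rewrite -scaler_suml; have := congr1 (fun w : 'rV_e => w 0 j) vC.
rewrite !mxE; under eq_bigr do rewrite mxE.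
by move=> ->; rewrite scale0r.
Qed.

Section Span.
Variables (K : fieldType) (V : lmodType K).
Implicit Types (S T : V -> Prop) (v w : V).

Lemma in_span_gen S v : S v -> in_span S v.
Proof.
by move=> Sv; exists 1%N, (fun=> 1), (fun=> v); rewrite big_ord1 scale1r.
Qed.

Lemma in_span0 S : in_span S 0.
Proof.
by exists 0%N, (fun=> 0), (fun=> 0); rewrite big_ord0; split=> // -[].
Qed.

Lemma in_spanD S v w : in_span S v -> in_span S w -> in_span S (v + w).
Proof.
move=> [k [c [s [Ss ->]]]] [l [c' [s' [Ss' ->]]]].
pose glue (U : Type) (g : 'I_k -> U) (h : 'I_l -> U) i :=
  match split i with inl j => g j | inr j => h j end.
exists (k + l)%N, (glue _ c c'), (glue _ s s'); split.
  by move=> i; rewrite /glue; case: split.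
rewrite big_split_ord /glue; congr (_ + _); apply: eq_bigr => i _.
  by rewrite (unsplitK (inl i)).
by rewrite (unsplitK (inr i)).
Qed.

Lemma in_spanZ S a v : in_span S v -> in_span S (a *: v).
Proof.
move=> [k [c [s [Ss ->]]]]; exists k, (fun i => a * c i), s; split=> //.
by rewrite scaler_sumr; apply: eq_bigr => i _; rewrite scalerA.
Qed.

Lemma in_span_ind S (P : V -> Prop) :
  P 0 -> (forall v w, P v -> P w -> P (v + w)) ->
  (forall a v, P v -> P (a *: v)) -> (forall v, S v -> P v) ->
  forall v, in_span S v -> P v.
Proof.
move=> P0 PD PZ PS _ [k [c [s [Ss ->]]]].
by elim/big_ind: _ => // i _; exact/PZ/PS.
Qed.

End Span.

Section PowerProducts.
Variables (R : pzSemiRingType) (n : nat) (x : 'I_n -> R).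
Hypothesis x_comm : forall i j, GRing.comm (x i) (x j).
Let pow (b : 'X_{1..n}) := \prod_(i < n) x i ^+ b i.

Lemma prod_exp_mnmD b c : pow (b + c) = pow b * pow c.
Proof.
rewrite -prodrM_comm => [|i j _ _]; last exact/commrX/commr_sym/commrX/x_comm.
by apply: eq_bigr => i _; rewrite mnmDE exprD.
Qed.

Lemma prod_exp_mnm0 : pow 0%MM = 1.
Proof. by rewrite /pow big1 // => i _; rewrite mnm0E. Qed.

Lemma prod_exp_mnm1 i : pow U_(i)%MM = x i.
Proof.
rewrite /pow (eq_bigr (fun j => if j == i then x j else 1)) => [|j _].
  by rewrite -big_mkcond big_pred1_eq.
by rewrite mnm1E eq_sym; case: (j == i).
Qed.

End PowerProducts.

(** * Bernstein filtration and right multiplication *)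

Section WeylFiltration.
Variables (K : fieldType) (n : nat).
Local Notation W := (weyl K n).
Local Notation B := (@bernstein_filtration K n).
Local Notation X := (@weylX K n).
Local Notation D := (@weylD K n).
Implicit Types (v w : W) (r s p : nat).

Lemma weylX_comm i j : GRing.comm (X i) (X j).
Proof.
by apply/val_inj/polyEndP => f; rewrite /= /mulX !mulrA ['X_i * _]mulrC.
Qed.

Lemma weylD_comm i j : GRing.comm (D i) (D j).
Proof. by apply/val_inj/polyEndP => f; apply: mderiv_comm. Qed.

(** This is the Leibniz rule applied to the product of ['X_j] and a polynomial. *)
Lemma weylD_X i j : D i * X j = X j * D i + ((i == j)%:R : K)%:A.
Proof.
apply/val_inj/polyEndP => f; rewrite /= /mulX mderivM addrC.
congr (_ + _); rewrite /= /polyEnd_scale /= mderivX mnm1E [j == i]eq_sym.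
have [->|_] := eqVneq i j; last by rewrite !scale0r mul0r.
by rewrite !scale1r -[X in (X - _)%MM]add0m addmK mpolyX0 mul1r.
Qed.

Lemma weyl_monomial_mulD a b i :
  weyl_monomial K a b * D i = weyl_monomial K a (b + U_(i)).
Proof.
rewrite /weyl_monomial -mulrA prod_exp_mnmD; last exact: weylD_comm.
by rewrite prod_exp_mnm1.
Qed.

Lemma bernstein_monomial a b r :
  (mdeg a + mdeg b <= r)%N -> B r (weyl_monomial K a b).
Proof. by move=> ab; apply: in_span_gen; exists a, b. Qed.

Lemma bernstein_leq r s v : (r <= s)%N -> B r v -> B s v.
Proof.
move=> le_rs; apply: in_span_ind => [|||_ [a [b [abr ->]]]].
- exact: in_span0.
- exact: in_spanD.
- exact: in_spanZ.
- exact/bernstein_monomial/(leq_trans abr).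
Qed.

Lemma bernstein_mul_monomial w r p :
  (forall a b, (mdeg a + mdeg b <= r)%N ->
    B (r + p) (weyl_monomial K a b * w)) ->
  forall v, B r v -> B (r + p) (v * w).
Proof.
move=> Bw; apply: in_span_ind => [|u v Bu Bv|c v Bv|_ [a [b [abr ->]]]].
- by rewrite mul0r; exact: in_span0.
- by rewrite mulrDl; exact: in_spanD.
- by rewrite -scalerAl; exact: in_spanZ.
- exact: Bw.
Qed.

Lemma bernstein_mulD i r v : B r v -> B (r + 1) (v * D i).
Proof.
apply: bernstein_mul_monomial => a b abr.
rewrite weyl_monomial_mulD; apply: bernstein_monomial.
by rewrite mdegD mdeg1 addnA leq_add2r.
Qed.

(** Normal ordering by induction on the order of the derivative monomial: moving [X i] left past one
    [D j] leaves a product ending in [D j], handled by [bernstein_mulD], plus a commutator term of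
    lower degree. *)
Lemma bernstein_mulX i r v : B r v -> B (r + 1) (v * X i).
Proof.
apply: bernstein_mul_monomial => a b.
have [k] := ubnP (mdeg b); elim: k => // k IHk in b r *; rewrite ltnS => bk abr.
have [b0|b0] := eqVneq b 0%MM.
  have -> : weyl_monomial K a b * X i = weyl_monomial K (a + U_(i)) 0.
    rewrite b0 /weyl_monomial !prod_exp_mnm0 !mulr1.
    rewrite prod_exp_mnmD ?prod_exp_mnm1 //.
    exact: weylX_comm.
  by apply: bernstein_monomial; rewrite mdegD mdeg1 mdeg0; lia.
have [j bj] : exists j, b j != 0%N.
  apply/existsP; apply: contraR b0; rewrite negb_exists => /forallP b0.
  by apply/eqP/mnmP => j; rewrite mnm0E; apply/eqP; have := b0 j; rewrite negbK.
have [c def_b] : exists c, b = (c + U_(j))%MM.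
  exists (b - U_(j))%MM; rewrite submK //.
  by apply/mnm_lepP => l; rewrite mnm1E; case: eqP => // <-; rewrite lt0n.
have mdb : mdeg b = (mdeg c).+1 by rewrite def_b mdegD mdeg1 addn1.
rewrite def_b -weyl_monomial_mulD -mulrA weylD_X mulrDr mulrA.
apply: in_spanD; last first.
  by rewrite -scalerAr mulr1; apply/in_spanZ/bernstein_monomial; lia.
(* Removing [D j] lowers the degree bound by one, so induction applies at [r] and the final [D j]
   restores the lost unit. *)
case: r abr => [|r] abr; first by lia.
by rewrite -[r.+1]addn1; apply/bernstein_mulD/IHk; lia.
Qed.

(* Unlike B_r B_s <= B_(r+s), this weaker statement passes trivially to        *)
(* products, so only the generators of A_n have to be checked.                 *)
Lemma bernstein_mulr_shift w :
  exists p, forall r v, B r v -> B (r + p) (v * w).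
Proof.
suff main g : in_weyl g -> forall u : W, val u = g ->
    exists p, forall r v, B r v -> B (r + p) (v * u).
  have /asboolP wg : val w \in @weyl_pred K n := valP w.
  exact: main wg _ erefl.
elim=> {w g} [i|i||c g wg IHg|g h wg IHg wh IHh|g h wg IHg wh IHh] u.
- move=> uE; have -> : u = X i by apply: val_inj.
  exists 1%N => r v; exact: bernstein_mulX.
- move=> uE; have -> : u = D i by apply: val_inj.
  exists 1%N => r v; exact: bernstein_mulD.
- move=> uE; have -> : u = 1 by apply: val_inj.
  exists 0%N => r v; by rewrite mulr1 addn0.
- move=> uE; have [p Bg] := IHg (Weyl (asboolT wg)) erefl.
  have -> : u = c *: Weyl (asboolT wg) by apply: val_inj.
  by exists p => r v Bv; rewrite -scalerAr; apply/in_spanZ/Bg.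
- move=> uE; have [p Bg] := IHg (Weyl (asboolT wg)) erefl.
  have [q Bh] := IHh (Weyl (asboolT wh)) erefl.
  have -> : u = Weyl (asboolT wg) + Weyl (asboolT wh) by apply: val_inj.
  exists (p + q)%N => r v Bv; rewrite mulrDr; apply: in_spanD.
    by apply: bernstein_leq (Bg _ _ Bv); lia.
  by apply: bernstein_leq (Bh _ _ Bv); lia.
- move=> uE; have [p Bg] := IHg (Weyl (asboolT wg)) erefl.
  have [q Bh] := IHh (Weyl (asboolT wh)) erefl.
  have -> : u = Weyl (asboolT wg) * Weyl (asboolT wh) by apply: val_inj.
  by exists (p + q)%N => r v Bv; rewrite mulrA addnA; apply/Bh/Bg.
Qed.

Variables (M : lmodType W) (m m' : nat) (f : 'I_m -> M) (f' : 'I_m' -> M).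

Lemma module_filtration_shift : generates f ->
  exists k, forall r (x : M),
    module_filtration f' r x -> module_filtration f (r + k) x.
Proof.
move=> f_gen.
have [w f'E] := choice (fun j => f_gen (f' j)).
have [p Bp] := choice (fun ji => bernstein_mulr_shift (w ji.1 ji.2)).
(* The finitely many coefficients [w j i] of the [f' j] in terms of the [f i] admit a common
   shift. *)
pose k := \max_ji p ji; exists k => r _ [b [Bb ->]].
exists (fun i => \sum_j b j * w j i); split=> [i|].
  elim/big_ind: _ => [||j _]; [exact: in_span0 | exact: in_spanD |].
  apply: bernstein_leq (Bp (j, i) _ _ (Bb j)).
  by rewrite leq_add2l (leq_bigmax (j, i)).
under eq_bigr do rewrite f'E scaler_sumr.
rewrite exchange_big; apply: eq_bigr => i _; rewrite scaler_suml.
by apply: eq_bigr => j _; rewrite scalerA.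
Qed.

Lemma bernstein_poly_shift chi chi' : generates f ->
  is_bernstein_poly f chi -> is_bernstein_poly f' chi' ->
  exists k r0, forall r, (r0 <= r)%N ->
    0 <= chi'.[r%:R] /\ chi'.[r%:R] <= chi.[(r + k)%:R].
Proof.
move=> /module_filtration_shift [k sub_k] [s chiE] [s' chi'E].
exists k, (s + s')%N => r le_r.
have [|d [dim_d ->]] := chi'E r; first by lia.
have [|e [dim_e ->]] := chiE (r + k)%N; first by lia.
rewrite ler0n ler_nat; split=> //.
by apply: has_dim_le dim_d dim_e; exact: sub_k.
Qed.

End WeylFiltration.

Theorem theorem14 (K : fieldType) (charK0 : [pchar K] =i pred0)
  (n : nat) (n_gt0 : (0 < n)%N) (M : lmodType (weyl K n))
  (m : nat) (f : 'I_m -> M) (f_gen : generates f)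
  (chi : {poly rat}) (chi_bern : is_bernstein_poly f chi)
  (a : nat -> int) (chi_a : binom_expansion n a chi)
  (m' : nat) (f' : 'I_m' -> M) (f'_gen : generates f')
  (chi' : {poly rat}) (chi'_bern : is_bernstein_poly f' chi')
  (a' : nat -> int) (chi'_a' : binom_expansion n a' chi') :
  [/\ a n.*2 = a' n.*2,
      poly_degree chi = poly_degree chi'
    & coef_at_degree a (poly_degree chi) =
      coef_at_degree a' (poly_degree chi')].
Proof.
have [k [r0 le_r]] := bernstein_poly_shift f_gen chi_bern chi'_bern.
have [k' [r0' le_r']] := bernstein_poly_shift f'_gen chi'_bern chi_bern.
have p'_ge0 r : (r0 <= r)%N -> 0 <= chi'.[r%:R] by case/le_r.
have p_ge0 r : (r0' <= r)%N -> 0 <= chi.[r%:R] by case/le_r'.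
have le_p'p r : (r0 <= r)%N -> chi'.[r%:R] <= chi.[(r + k)%:R] by case/le_r.
have le_pp' r : (r0' <= r)%N -> chi.[r%:R] <= chi'.[(r + k')%:R] by case/le_r'.
have eq_size : size chi = size chi'.
  apply/eqP; rewrite eqn_leq (eventually_le_size p_ge0 le_pp').
  exact: eventually_le_size p'_ge0 le_p'p.
have eq_lead : lead_coef chi = lead_coef chi'.
  apply: le_anti; rewrite (eventually_le_lead_coef le_pp') //.
  by rewrite (eventually_le_lead_coef le_p'p).
have eq_top : chi`_n.*2 = chi'`_n.*2.
  have sz_le : (size chi <= n.*2.+1)%N by rewrite chi_a size_binom_sum.
  (* Below degree $2n$ both coefficients are 0; otherwise the degree is $2n$ and they are the
     leading coefficients. *)
  have [sz_lt|sz_ge] := leqP (size chi) n.*2.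
    by rewrite !nth_default -?eq_size.
  have szE : (size chi).-1 = n.*2 by lia.
  by move: eq_lead; rewrite !lead_coefE -eq_size szE.
split.
- apply: (@intr_inj rat); rewrite !coef_binom_sum_top.
  by rewrite -[\sum_(_ <= _ < _) _]chi_a -[\sum_(_ <= _ < _) _]chi'_a' eq_top.
- by rewrite /poly_degree eq_size.
- apply: (@intr_inj rat); rewrite chi_a chi'_a' !coef_at_degree_binom_sum.
  by rewrite -chi_a -chi'_a' eq_lead eq_size.
Qed.
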